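(* Let $n\ge 3$ be an integer, $0<m<\frac{n-2}{n}$, $\alpha,\beta\in\mathbb{R}$, $\gamma>0$ with $\gamma\ne\frac{2}{1-m}$, $\eta>0$ and $\varepsilon>0$. Let $B_{\varepsilon}=\{x\in\mathbb{R}^n:|x|<\varepsilon\}$. Suppose there exists a radially symmetric solution $f$ of $$\Delta (f^m/m)+\alpha f+\beta x\cdot\nabla f=0,\quad f>0,\quad\text{ in }B_{\varepsilon}\setminus\{0\}$$ which satisfies $$\lim_{|x|\to 0}|x|^{\gamma}f(x)=\eta.$$ Then either (i) $\alpha=\beta=0$ holds, or (ii) $\alpha\in\mathbb{R}$ and $\beta\ne 0$ holds, with $$\gamma=\frac{\alpha}{\beta}\quad\text{ and }\quad\gamma>\frac{2}{1-m}.$$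
   Context: ''Solution'' means a classical (twice continuously differentiable) positive function satisfying the equation pointwise on the indicated punctured ball. Radially symmetric means that $f(x)$ depends only on $|x|$. *)

(* Defs.v *)
From HB Require Import structures.
From mathcomp Require Import all_boot all_order all_algebra.
From mathcomp Require Import all_classical all_reals all_analysis.

Set Implicit Arguments.
Unset Strict Implicit.
Unset Printing Implicit Defensive.
Import Order.TTheory GRing.Theory Num.Theory.
Import numFieldNormedType.Exports.

Local Open Scope classical_set_scope.
Local Open Scope ring_scope.

Section Euclidean.
Context {R : realType} {n : nat}.
Implicit Types (x y : 'rV[R]_n) (f : 'rV[R]_n -> R).

Definition dotp x y : R := \sum_(i < n) x 0 i * y 0 i.

(* The library norm on 'rV[R]_n is the sup norm; it induces the same topology,
   but balls and radial symmetry have to refer to the Euclidean norm. *)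
Definition enorm x : R := Num.sqrt (dotp x x).

Definition punctured_ball (eps : R) : set 'rV[R]_n :=
  [set x | enorm x < eps /\ x <> 0].

Definition partial (i : 'I_n) f : 'rV[R]_n -> R := 'D_(delta_mx 0 i) f.

Definition gradient f x : 'rV[R]_n := \row_(i < n) partial i f x.

Definition laplacian f x : R := \sum_(i < n) partial i (partial i f) x.

(* C^k on U, meant for open U, where only the values of f on U matter. *)
Fixpoint Ck_on (k : nat) (U : set 'rV[R]_n) f : Prop :=
  (forall x, U x -> {for x, continuous f}) /\
  match k with
  | 0 => True
  | k'.+1 => forall i : 'I_n,
      (forall x, U x -> derivable f x (delta_mx 0 i)) /\
      Ck_on k' U (partial i f)
  end.

Definition radial_on (U : set 'rV[R]_n) f : Prop :=
  forall x y, U x -> U y -> enorm x = enorm y -> f x = f y.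

Definition is_solution (m alpha beta : R) (U : set 'rV[R]_n) f : Prop :=
  [/\ Ck_on 2 U f,
      forall x, U x -> 0 < f x &
      forall x, U x ->
        laplacian (fun y => f y `^ m / m) x
          + alpha * f x + beta * dotp x (gradient f x) = 0].

End Euclidean.

(* Main.v *)
Require Import Defs.
From HB Require Import structures.
From mathcomp Require Import all_boot all_order all_algebra.
From mathcomp Require Import all_classical all_reals all_analysis.
From mathcomp Require Import ring lra.

Set Implicit Arguments.
Unset Strict Implicit.
Unset Printing Implicit Defensive.
Import Order.TTheory GRing.Theory Num.Theory.
Import numFieldNormedType.Exports.

Local Open Scope classical_set_scope.
Local Open Scope ring_scope.

(** Write [f x = u |x|] and [W = u `^ m / m]; on a half-axis the equation reads
    [W'' + (n - 1) / r W' + alpha u + beta r u' = 0] ([radial_profile], which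
    rests on [radial_laplacian]).  If [u] is asymptotic to [eta r `^ (- gamma)]
    at 0, and if this could be differentiated, the diffusion terms would be of
    order [r `^ (- gamma m - 2)], with coefficient
    [gamma m (gamma m - (n - 2)) eta `^ m / m], and the lower-order terms of
    order [r `^ (- gamma)], with coefficient [(alpha - beta gamma) eta].  The two
    orders agree exactly when [gamma = 2 / (1 - m)], which is excluded, so the
    dominant coefficient has to vanish.

    When [gamma < 2 / (1 - m)] the diffusion dominates.  Its coefficient is
    nonzero: [m < (n - 2) / n] gives [2 m / (1 - m) < n - 2], whence
    [0 < gamma m < n - 2].  This case is impossible.  When
    [gamma > 2 / (1 - m)] the lower-order terms dominate, hence
    [alpha = beta gamma]: either [beta = 0], and then [alpha = 0], or
    [gamma = alpha / beta].

    An asymptotic equivalence cannot be differentiated in general, and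
    [exponent_balance] makes the comparison rigorous: a suitable power of [r]
    turns the equation into [r P' = (a convergent function)], where [P] involves
    derivatives of the solution only through [r z'] with [z] convergent.  The
    mean value theorem then shows that the limit of [r P'] is zero
    ([log_derivative_cvg_eq0]). *)

(** * A real-variable limit argument at zero *)

Lemma MVT_pos (R : realType) (F dF : R -> R) (eps a b : R) :
  (forall r, 0 < r < eps -> is_derive r 1 F (dF r)) ->
  0 < a -> a < b -> b < eps ->
  exists2 c, a < c < b & F b - F a = dF c * (b - a).
Proof.
move=> FdF a0 ab be.
have dF_ab x : x \in `[a, b] -> is_derive x 1 F (dF x).
  by rewrite in_itv /= => /andP[ax xb]; apply: FdF; apply/andP; split; lra.
have dF_oo x : x \in `]a, b[ -> is_derive x 1 F (dF x).
  by move=> /subset_itv_oo_cc; apply: dF_ab.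
have cF : {within `[a, b], continuous F}.
  by apply: derivable_within_continuous => x /dF_ab [].
have [c cab ->] := MVT ab dF_oo cF.
by exists c; rewrite ?in_itv /= in cab *.
Qed.

(** This is where the asymptotics of an unknown profile turns into a condition
    on its exponents.  If [r * dP r] tends to [L], then [P] varies over [r, 4r]
    by about [L] times the logarithm of the ratio of the end points.  A bound
    on this variation needs some control on [dz], whereas only [z] itself is
    known to converge; but the mean value theorem gives, in [r, 2r] and in
    [3r, 4r], points [a] and [b] where [r * dz r] is small.  At such points [P]
    is close to the limit of [Q], so [P b - P a] is small although [b / a] stays
    away from 1, which forces [L = 0]. *)
Lemma log_derivative_cvg_eq0 (R : realType) (P dP z dz E Q : R -> R)
    (eps zeta kappa L : R) : 0 < eps ->
  (forall r, 0 < r < eps -> is_derive r 1 z (dz r)) ->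
  (forall r, 0 < r < eps -> is_derive r 1 P (dP r)) ->
  (forall r, 0 < r < eps -> P r = E r * (r * dz r) + Q r) ->
  (forall r, 0 < r < eps -> `|E r| <= 1) ->
  z r @[r --> 0^'+] --> zeta ->
  Q r @[r --> 0^'+] --> kappa ->
  r * dP r @[r --> 0^'+] --> L ->
  L = 0.
Proof.
move=> eps0 zP PP PE E1 zl Ql dPl; apply/eqP; apply: contraT => L0.
(* 73 = 72 + 1, where 72 = 4 * (8 + 8 + 2) bounds |c * dP c| / e below. *)
pose e := `|L| / 73.
have e0 : 0 < e by rewrite divr_gt0 ?normr_gt0.
have [d [d0 deps dP3]] : exists d, [/\ 0 < d, d < eps & forall r, 0 < r < d ->
    [/\ `|zeta - z r| < e, `|kappa - Q r| < e & `|L - r * dP r| < e]].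
  have : \forall r \near 0^'+,
      [/\ `|zeta - z r| < e, `|kappa - Q r| < e & `|L - r * dP r| < e].
    near=> r; split; near: r.
    - by move/cvgrPdist_lt : zl; apply.
    - by move/cvgrPdist_lt : Ql; apply.
    - by move/cvgrPdist_lt : dPl; apply.
  rewrite near_withinE => /nbhs_ballP[d /= d0 dball].
  exists (Num.min d (eps / 2)); split.
  - by rewrite lt_min d0 divr_gt0.
  - by rewrite gt_min (_ : eps / 2 < eps) ?orbT//; lra.
  - move=> r /andP[r0]; rewrite lt_min => /andP[rd _].
    by apply: dball => //; rewrite /ball /= sub0r normrN gtr0_norm.
(* With a fifth of d, the points up to 4r stay strictly below d. *)
pose r := d / 5.
have r0 : 0 < r by rewrite divr_gt0.
have rd : 5 * r = d by rewrite /r; field.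
have z_osc s t : 0 < s < d -> 0 < t < d -> `|z s - z t| < 2 * e.
  move=> /dP3[+ _ _] /dP3[+ _ _].
  by rewrite !ltr_norml => /andP[? ?] /andP[? ?]; apply/andP; split; lra.
have small s : r <= s -> s + r <= 4 * r ->
    exists2 a, s < a < s + r & `|a * dz a| < 8 * e.
  move=> rs s4.
  have [|||a /andP[sa ar] za] := @MVT_pos R z dz eps s (s + r) zP; try lra.
  exists a; first by rewrite sa ar.
  have a0 : 0 < a by lra.
  have dza : `|dz a| * r < 2 * e.
    rewrite -(gtr0_norm r0) -normrM.
    have -> : dz a * r = z (s + r) - z s by rewrite za; ring.
    by apply: z_osc; apply/andP; split; lra.
  rewrite normrM (gtr0_norm a0).
  apply: (@le_lt_trans _ _ (4 * (`|dz a| * r))); last by lra.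
  by rewrite mulrC [leRHS]mulrCA ler_wpM2l//; lra.
have [||a /andP[ra ar] dza] := small r; try lra.
have [||b /andP[rb br] dzb] := small (3 * r); try lra.
have [|||c /andP[ac cb] Pab] := @MVT_pos R P dP eps a b PP; try lra.
have E_small x : 0 < x < eps -> `|x * dz x| < 8 * e ->
    `|E x * (x * dz x)| < 8 * e.
  by move=> /E1 Ex; apply: le_lt_trans; rewrite normrM ler_piMl.
have [|_ Qa _] := dP3 a; try by apply/andP; split; lra.
have [|_ Qb _] := dP3 b; try by apply/andP; split; lra.
have [|_ _ Lc] := dP3 c; try by apply/andP; split; lra.
have Pba : `|P b - P a| < 18 * e.
  have ha : 0 < a < eps by apply/andP; split; lra.
  have hb : 0 < b < eps by apply/andP; split; lra.
  move: (E_small _ ha dza) (E_small _ hb dzb); rewrite PE// PE//.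
  move: Qa Qb; rewrite !ltr_norml.
  by move=> /andP[? ?] /andP[? ?] /andP[? ?] /andP[? ?]; apply/andP; split; lra.
have cdP : `|c * dP c| < 72 * e.
  rewrite normrM gtr0_norm; last by lra.
  have dPr : `|dP c| * r < 18 * e.
    apply: le_lt_trans Pba; rewrite Pab normrM ler_wpM2l//.
    by rewrite gtr0_norm; lra.
  apply: (@le_lt_trans _ _ (4 * (`|dP c| * r))); last by lra.
  by rewrite mulrC [leRHS]mulrCA ler_wpM2l//; lra.
have : `|L| < 73 * e.
  rewrite -[L](subrK (c * dP c)).
  by apply: le_lt_trans (ler_normD _ _) _; lra.
by rewrite /e mulrC divfK ?ltxx.
Unshelve. all: by end_near. Qed.

(** * Euclidean geometry of a coordinate axis *)

(** Directional derivatives in space are ordinary derivatives along lines, since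
    the two difference quotients are the same function of the increment. *)
Lemma is_derive_line (R : realType) (n : nat) (f : 'rV[R]_n -> R)
    (x v : 'rV[R]_n) (r d : R) :
  is_derive r 1 (fun s => f (s *: v + x)) d <-> is_derive (r *: v + x) v f d.
Proof.
have quotientE : (fun h => h^-1 *:
      (((fun s => f (s *: v + x)) \o shift r) (h *: 1) - f (r *: v + x))) =
    (fun h => h^-1 *: ((f \o shift (r *: v + x)) (h *: v) - f (r *: v + x))).
  by apply/funext => h /=; rewrite [h%:A]mulr1 scalerDl addrA.
split=> -[dd dE]; by split; move: dd dE; rewrite /derivable /derive quotientE.
Qed.

Section Plane.
Context {R : realType} {n : nat}.
Implicit Types (i j : 'I_n) (r s t : R).

Lemma enorm_axis i r : 0 <= r -> enorm (r *: delta_mx 0 i : 'rV[R]_n) = r.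
Proof.
move=> r0; rewrite /enorm /dotp (bigD1 i)//= big1 ?addr0.
  by rewrite !mxE !eqxx mulr1 -expr2 sqrtr_sqr ger0_norm.
by move=> j ji; rewrite !mxE (negPf ji) andbF mulr0 mul0r.
Qed.

Lemma enorm_plane i j t r : i != j ->
  enorm (t *: delta_mx 0 i + r *: delta_mx 0 j : 'rV[R]_n) =
  Num.sqrt (t ^+ 2 + r ^+ 2).
Proof.
move=> ij; have ji : j != i by rewrite eq_sym.
rewrite /enorm /dotp (bigD1 i)//= (bigD1 j)//= big1 ?addr0.
  rewrite !mxE !eqxx (negPf ij) (negPf ji).
  by rewrite !mulr1 !mulr0 addr0 add0r !expr2.
by move=> k /andP[ki kj]; rewrite !mxE (negPf ki) (negPf kj) !andbF !mulr0 addr0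
  mul0r.
Qed.

Lemma dotp_axis i r (y : 'rV[R]_n) : dotp (r *: delta_mx 0 i) y = r * y 0 i.
Proof.
rewrite /dotp (bigD1 i)//= big1 ?addr0; first by rewrite !mxE !eqxx mulr1.
by move=> j ji; rewrite !mxE (negPf ji) andbF mulr0 mul0r.
Qed.

Lemma axis_neq0 i r : r != 0 -> r *: delta_mx 0 i <> 0 :> 'rV[R]_n.
Proof.
by move=> r0 /rowP/(_ i)/eqP; rewrite !mxE !eqxx mulr1 (negPf r0).
Qed.

Lemma axis_punctured_ball eps i r :
  0 < r < eps -> punctured_ball eps (r *: delta_mx 0 i : 'rV[R]_n).
Proof.
move=> /andP[r0 re]; split; first by rewrite enorm_axis // ltW.
by apply: axis_neq0; rewrite gt_eqF.
Qed.

Lemma plane_punctured_ball eps i j t r : i != j -> 0 < r ->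
  Num.sqrt (t ^+ 2 + r ^+ 2) < eps ->
  punctured_ball eps (t *: delta_mx 0 i + r *: delta_mx 0 j : 'rV[R]_n).
Proof.
move=> ij r0 tr; have ji : j != i by rewrite eq_sym.
split; first by rewrite enorm_plane.
move=> /rowP/(_ j)/eqP; rewrite !mxE !eqxx (negPf ji) mulr0 add0r mulr1.
by rewrite gt_eqF.
Qed.

Lemma radial_plane eps (F : 'rV[R]_n -> R) i j t r :
  radial_on (punctured_ball eps) F -> i != j -> 0 < r ->
  Num.sqrt (t ^+ 2 + r ^+ 2) < eps ->
  F (t *: delta_mx 0 i + r *: delta_mx 0 j) =
  F (Num.sqrt (t ^+ 2 + r ^+ 2) *: delta_mx 0 j).
Proof.
move=> radF ij r0 tr.
have tr0 : 0 < t ^+ 2 + r ^+ 2 by rewrite ltr_wpDl ?sqr_ge0 ?exprn_gt0.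
apply: radF; first exact: plane_punctured_ball.
  by apply: axis_punctured_ball; rewrite sqrtr_gt0 tr0.
by rewrite enorm_plane// enorm_axis// sqrtr_ge0.
Qed.

End Plane.

Lemma cvg_axis_dnbhs (R : realType) (n : nat) (j : 'I_n) :
  (r *: delta_mx 0 j : 'rV[R]_n) @[r --> (0 : R)^'+] --> (0 : 'rV[R]_n)^'.
Proof.
have axis_cont :
    (r *: delta_mx 0 j : 'rV[R]_n) @[r --> (0 : R)] --> (0 : 'rV[R]_n).
  have := @scalel_continuous R _ (delta_mx 0 j : 'rV[R]_n) 0.
  by rewrite /continuous_at scale0r.
move=> A /axis_cont A0.
change (\forall r \near (0 : R)^'+, A (r *: delta_mx 0 j)); near=> r.
have r0 : 0 < r by [].
have : (r *: delta_mx 0 j : 'rV[R]_n) != 0.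
  by apply/eqP/axis_neq0; rewrite gt_eqF.
near: r; exact: cvg_at_right_filter A0.
Unshelve. all: by end_near. Qed.

(** * The radial reduction *)

(** Away from the axis direction [j], moving by [t] in direction [i] from
    [r *: delta_mx 0 j] only changes the radius to [rho t], the square root of
    [t ^+ 2 + r ^+ 2].  The first derivative is therefore
    [dW (rho t) / rho t * t], and the second one at [t = 0] is the value of the
    continuous factor of [t], namely [dW r / r]: there are [n - 1] such
    directions. *)
Lemma radial_laplacian (R : realType) (n : nat) (eps : R) (F : 'rV[R]_n -> R)
    (j : 'I_n) (dW : R -> R) (r ddW : R) :
  radial_on (punctured_ball eps) F ->
  (forall s : R, 0 < s < eps ->
     is_derive s 1 (fun s => F (s *: delta_mx 0 j)) (dW s)) ->
  0 < r < eps -> is_derive r 1 dW ddW ->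
  laplacian F (r *: delta_mx 0 j) = ddW + (n%:R - 1) * (dW r / r).
Proof.
move=> radF FdW /andP[r0 re] dWr.
have radial_part : partial j (partial j F) (r *: delta_mx 0 j) = ddW.
  apply: derive_val; rewrite -[X in is_derive X _ _ _](addr0 _).
  apply/is_derive_line.
  apply: near_eq_is_derive dWr; near=> s.
  apply/esym/derive_val/is_derive_line.
  under eq_fun do rewrite addr0.
  by apply: FdW; apply/andP; split; near: s; [exact: lt_nbhsr | exact: lt_nbhsl].
pose rho (t : R) : R := Num.sqrt (t ^+ 2 + r ^+ 2).
have rho0 : rho 0 = r by rewrite /rho expr0n add0r sqrtr_sqr gtr0_norm.
have rho_gt0 (t : R) : 0 < rho t.
  by rewrite sqrtr_gt0 ltr_wpDl ?sqr_ge0 ?exprn_gt0.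
have rho_derive (t : R) : is_derive t 1 rho (t / rho t).
  have tr0 : 0 < t ^+ 2 + r ^+ 2 by rewrite -sqrtr_gt0; exact: rho_gt0.
  have := is_derive1_sqrt tr0 => dsqrt.
  have dsq : is_derive t 1 (fun t : R => t ^+ 2 + r ^+ 2) (2 * t).
    rewrite (_ : (fun _ => _) = (@id R) ^+ 2 + cst (r ^+ 2)); last by [].
    by apply: is_derive_eq; rewrite addr0 expr1 [_%:A]mulr1.
  apply: (is_derive_eq
    (is_derive1_comp (g := fun t : R => t ^+ 2 + r ^+ 2) dsqrt dsq)).
  by have := rho_gt0 t; rewrite /rho => rt; field; lra.
have rho_cont : continuous rho.
  by move=> t; have [/derivable1_diffP/differentiable_continuous] := rho_derive t.
have rho_lt : \forall t \near 0, rho t < eps.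
  by have := rho_cont 0 => /cvgr_lt; rewrite rho0; apply.
have tangential_part i : i != j ->
    partial i (partial i F) (r *: delta_mx 0 j) = dW r / r.
  move=> ij; apply: derive_val.
  rewrite -[X in is_derive X _ _ _](add0r _) -(scale0r (delta_mx 0 i)).
  apply/is_derive_line.
  apply: (@near_eq_is_derive _ _ _ (fun t => dW (rho t) / rho t * t)).
    near=> t; apply/esym/derive_val/is_derive_line.
    have rt : rho t < eps by near: t.
    apply: (@near_eq_is_derive _ _ _ ((fun s => F (s *: delta_mx 0 j)) \o rho)).
      have : \forall s \near t, rho s < eps.
        by have := rho_cont t => /cvgr_lt; apply.
      by apply: filterS => s rs; rewrite /= (radial_plane radF).
    have FdWt := FdW (rho t) (introT andP (conj (rho_gt0 t) rt)).
    apply: (is_derive_eq (is_derive1_comp FdWt (rho_derive t))).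
    by rewrite mulrA mulrAC.
  (* dW need not be differentiated again: t times a continuous function of t
     is differentiable at 0. *)
  apply/is_derive1_caratheodory; exists (fun t => dW (rho t) / rho t); split.
  - by move=> z; rewrite mulr0 !subr0.
  - have dWc : {for rho 0, continuous dW}.
      rewrite rho0.
      by have [/derivable1_diffP/differentiable_continuous] := dWr.
    apply: cvgM; first exact: (continuous_comp (rho_cont 0) dWc).
    apply: cvgV; first by rewrite gt_eqF.
    exact: rho_cont.
  - by rewrite rho0.
rewrite /laplacian (bigD1 j)//= radial_part; congr (_ + _).
rewrite (eq_bigr (fun=> dW r / r)); last exact: tangential_part.
rewrite sumr_const cardC1 card_ord -[LHS]mulr_natl.
by rewrite -[in RHS](ltn_predK (ltn_ord j)) -natr1 addrK.
Unshelve. all: by end_near. Qed.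

(** The restriction of a radial solution to a half-axis solves the radial
    ordinary differential equation; [dW] and [ddW] are the first two derivatives
    of its [m]-th power divided by [m]. *)
Lemma radial_profile (R : realType) (n : nat) (m alpha beta eps : R)
    (f : 'rV[R]_n -> R) (j : 'I_n) :
  m != 0 ->
  radial_on (punctured_ball eps) f ->
  is_solution m alpha beta (punctured_ball eps) f ->
  exists du dW ddW : R -> R, forall r, 0 < r < eps ->
  [/\ 0 < f (r *: delta_mx 0 j),
      is_derive r 1 (fun s : R => f (s *: delta_mx 0 j)) (du r),
      is_derive r 1 (fun s : R => f (s *: delta_mx 0 j) `^ m / m) (dW r),
      is_derive r 1 dW (ddW r) &
      ddW r + (n%:R - 1) * (dW r / r) + alpha * f (r *: delta_mx 0 j)
        + beta * (r * du r) = 0].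
Proof.
move=> m0 radf [[_ /(_ j)[fj [_ /(_ j)[fjj _]]]] f0 pde].
pose e : 'rV[R]_n := delta_mx 0 j.
pose u (s : R) : R := f (s *: e).
pose du (s : R) : R := partial j f (s *: e).
pose ddu (s : R) : R := partial j (partial j f) (s *: e).
have udu r : 0 < r < eps -> is_derive r 1 u (du r).
  move=> /(axis_punctured_ball j) /fj /derivableP; rewrite -/e.
  rewrite -[X in is_derive X](addr0 (r *: e)) => /is_derive_line.
  by under eq_fun do rewrite addr0.
have duddu r : 0 < r < eps -> is_derive r 1 du (ddu r).
  move=> /(axis_punctured_ball j) /fjj /derivableP; rewrite -/e.
  rewrite -[X in is_derive X](addr0 (r *: e)) => /is_derive_line.
  by under eq_fun do rewrite addr0.
have u0 r : 0 < r < eps -> 0 < u r by move=> /(axis_punctured_ball j) /f0.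
have upow a r : 0 < r < eps ->
    is_derive r 1 (fun s => u s `^ a) (a * u r `^ (a - 1) * du r).
  move=> re; exact: (is_derive1_comp (is_derive1_powR a (u0 _ re)) (udu _ re)).
pose dW (s : R) : R := u s `^ (m - 1) * du s.
pose ddW (s : R) : R :=
  u s `^ (m - 1) * ddu s + du s * ((m - 1) * u s `^ (m - 1 - 1) * du s).
have WdW r : 0 < r < eps -> is_derive r 1 (fun s : R => u s `^ m / m) (dW r).
  move=> re; rewrite (_ : (fun _ => _) = m^-1 \*: (fun s => u s `^ m)).
    apply: (is_derive_eq (is_deriveZ m^-1 (upow m r re))).
    by rewrite /dW /GRing.scale /=; field.
  by apply/funext => s; rewrite /GRing.scale /= mulrC.
have dWddW r : 0 < r < eps -> is_derive r 1 dW (ddW r).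
  move=> re; exact: (is_deriveM (upow (m - 1) r re) (duddu r re)).
exists du, dW, ddW => r re; split; [exact: u0|exact: udu|exact: WdW|exact: dWddW|].
have radF : radial_on (punctured_ball eps) (fun y => f y `^ m / m).
  by move=> x y xe ye xy; rewrite (radf x y).
rewrite -(radial_laplacian radF WdW re (dWddW r re)).
rewrite -[RHS](pde (r *: e) (axis_punctured_ball j re)).
by rewrite dotp_axis mxE.
Qed.

(** * Balance of exponents *)

Lemma is_derive_powRM (R : realType) (a r dg : R) (g : R -> R) : 0 < r ->
  is_derive r 1 g dg ->
  is_derive r 1 (fun s => s `^ a * g s) (r `^ a * dg + a * r `^ (a - 1) * g r).
Proof.
move=> r0 gr.
rewrite (_ : (fun _ => _) = (fun s => s `^ a) * g); last by [].
apply: (is_derive_eq (is_deriveM (is_derive1_powR a r0) gr)).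
by congr (_ + _); exact: mulrC.
Qed.

Lemma powR_ge0_cvg (R : realType) (a : R) : 0 <= a ->
  s `^ a @[s --> 0^'+] --> ((a == 0)%:R : R).
Proof.
rewrite le_eqVlt => /predU1P[<-|a0]; last first.
  by rewrite gt_eqF//; exact: powR_cvg0.
by rewrite eqxx; under eq_fun do rewrite powRr0; exact: cvg_cst.
Qed.

Lemma near_eq_cvg_lim (T : Type) (V : topologicalType) (F : set_system T)
    (FF : Filter F) (f g : T -> V) (l : V) :
  (\forall x \near F, f x = g x) -> f @ F --> l -> g @ F --> l.
Proof. by move=> fg; apply: cvg_trans; exact: near_eq_cvg. Qed.

(** Multiplying the radial equation by [r `^ (q + 1)] makes its principal part an
    exact derivative, up to terms without derivatives: with
    [P = r `^ (q + 1) W' + (N - 2 - q) r `^ q W + beta r `^ (q + 2) u],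
    where [W = u `^ m / m], one gets
    [r P' = (N - 2 - q) q r `^ q W + (beta (q + 2) - alpha) r `^ (q + 2) u].
    Since [u] behaves like [eta r `^ (- gamma)], the right-hand side converges
    for every [q >= gamma * m, gamma - 2], the two terms surviving only in case
    of equality, and the limit vanishes by [log_derivative_cvg_eq0], applied to
    the convergent function [z = r `^ (gamma m) W]. *)
Lemma exponent_balance (R : realType) (m alpha beta gamma eta eps N q : R)
    (u du dW ddW : R -> R) :
  0 < eps -> 0 < eta ->
  (forall r : R, 0 < r < eps ->
     [/\ 0 < u r, is_derive r 1 u (du r),
         is_derive r 1 (fun s : R => u s `^ m / m) (dW r),
         is_derive r 1 dW (ddW r) &
         ddW r + (N - 1) * (dW r / r) + alpha * u r + beta * (r * du r) = 0]) ->
  r `^ gamma * u r @[r --> 0^'+] --> eta ->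
  gamma * m <= q -> gamma - 2 <= q ->
  (N - 2 - q) * q * ((q == gamma * m)%:R * (eta `^ m / m))
    + (beta * (q + 2) - alpha) * ((q == gamma - 2)%:R * eta) = 0.
Proof.
move=> eps0 eta0 prof ul mq gq.
set p := gamma * m in mq *.
pose W (r : R) : R := u r `^ m / m.
have powD (a b r : R) : 0 < r -> r `^ (a + b) = r `^ a * r `^ b :> R.
  by move=> r0; rewrite powRD// (gt_eqF r0) implybT.
have Wl : r `^ p * W r @[r --> 0^'+] --> eta `^ m / m.
  have um : (r `^ gamma * u r) `^ m @[r --> 0^'+] --> eta `^ m.
    apply: (@continuous_cvg _ _ _ _ _ _ (fun x : R => x `^ m)) ul.
    by have [/derivable1_diffP/differentiable_continuous] :=
      is_derive1_powR m eta0.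
  apply: near_eq_cvg_lim (cvgM um (cvg_cst m^-1)).
  near=> r.
  have r0 : 0 < r by [].
  have ur : 0 < u r.
    have /prof[] // : 0 < r < eps.
    by rewrite r0; near: r; exact: nbhs_right_lt.
  by rewrite /= powRM ?powR_ge0 ?(ltW ur)// -powRrM mulrA.
have Wql : r `^ q * W r @[r --> 0^'+] --> (q == p)%:R * (eta `^ m / m).
  have qp : 0 <= q - p by rewrite subr_ge0.
  rewrite -subr_eq0.
  apply: near_eq_cvg_lim (cvgM (powR_ge0_cvg qp) Wl); near=> r.
  by rewrite /= mulrA -powD// subrK.
have uql : r `^ (q + 2) * u r @[r --> 0^'+] --> (q == gamma - 2)%:R * eta.
  have qg : 0 <= q + 2 - gamma by lra.
  have <- : (q + 2 - gamma == 0) = (q == gamma - 2).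
    by apply/eqP/eqP => ?; lra.
  apply: near_eq_cvg_lim (cvgM (powR_ge0_cvg qg) ul); near=> r.
  by rewrite /= mulrA -powD// subrK.
pose P (r : R) : R := r `^ (q + 1) * dW r + (N - 2 - q) * (r `^ q * W r)
            + beta * (r `^ (q + 2) * u r).
pose dP (r : R) : R := r `^ (q + 1) * ddW r + (q + 1) * r `^ q * dW r
  + (N - 2 - q) * (r `^ q * dW r + q * r `^ (q - 1) * W r)
  + beta * (r `^ (q + 2) * du r + (q + 2) * r `^ (q + 1) * u r).
(* Below radius 1 the factor r `^ (q - p) of r z' in P is at most 1. *)
pose eps1 := Num.min eps 1.
have in_eps (r : R) : 0 < r < eps1 -> 0 < r < eps.
  by rewrite lt_min => /andP[-> /andP[->]].
apply: (@log_derivative_cvg_eq0 _ P dP (fun r => r `^ p * W r)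
  (fun r => r `^ p * dW r + p * r `^ (p - 1) * W r)
  (fun r => r `^ (q - p))
  (fun r => (N - 2 - q - p) * (r `^ q * W r) + beta * (r `^ (q + 2) * u r))
  eps1).
- by rewrite lt_min eps0 ltr01.
- move=> r /in_eps re; have [_ _ WdW _ _] := prof r re.
  by apply: is_derive_powRM WdW; case/andP: re.
- move=> r /in_eps re; have r0 : 0 < r by case/andP: re.
  have [_ udu WdW dWddW _] := prof r re.
  have d1 := is_derive_powRM (q + 1) r0 dWddW.
  have d2 := is_derive_powRM q r0 WdW.
  have d3 := is_derive_powRM (q + 2) r0 udu.
  have := is_deriveD (is_deriveD d1 (is_deriveZ (N - 2 - q) d2))
    (is_deriveZ beta d3).
  by rewrite /dP addrK (_ : q + 2 - 1 = q + 1)//; lra.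
- move=> r /andP[r0 _]; rewrite /P.
  have -> : r `^ (q + 1) = r `^ (q - p) * (r * r `^ p).
    by rewrite mulrCA -powD// subrK powD// powRr1 ?ltW// mulrC.
  have -> : r `^ q = r `^ (q - p) * r `^ p by rewrite -powD// subrK.
  have -> : r `^ p = r * r `^ (p - 1).
    by rewrite -[X in X * _](powRr1 (ltW r0)) -powD// subrKC.
  by ring.
- move=> r /andP[r0]; rewrite lt_min => /andP[_ r1].
  rewrite ger0_norm ?powR_ge0// -[leRHS](powRr0 r) ger_powR ?subr_ge0//.
  by rewrite r0 ltW.
- exact: Wl.
- exact: cvgD (cvgM (cvg_cst _) Wql) (cvgM (cvg_cst _) uql).
- apply: near_eq_cvg_lim (cvgD (cvgM (cvg_cst ((N - 2 - q) * q)) Wql)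
    (cvgM (cvg_cst (beta * (q + 2) - alpha)) uql)).
  near=> r.
  have r0 : 0 < r by [].
  have re : 0 < r < eps.
    by rewrite r0; near: r; exact: nbhs_right_lt.
  have powS a : r `^ (a + 1) = r `^ a * r by rewrite powD// powRr1// ltW.
  rewrite /dP !fctE /=.
  have -> : q + 2 = q - 1 + 1 + 1 + 1 by ring.
  have -> : r `^ q = r `^ (q - 1) * r by rewrite -powS subrK.
  have -> : r `^ (q + 1) = r `^ (q - 1) * r * r by rewrite -!powS subrK.
  rewrite !powS.
  have -> : ddW r = - (N - 1) * (dW r / r) - alpha * u r - beta * (r * du r).
    by have [_ _ _ _ ode] := prof r re; lra.
  by field; rewrite gt_eqF.
Unshelve. all: by end_near. Qed.

(** * The theorem *)

Theorem theorem1p1 (R : realType) (n : nat)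
    (m alpha beta gamma eta eps : R)
    (hn : (3 <= n)%N)
    (hm0 : 0 < m) (hm1 : m < (n%:R - 2) / n%:R)
    (hgamma0 : 0 < gamma) (hgamma : gamma <> 2 / (1 - m))
    (heta : 0 < eta) (heps : 0 < eps)
    (hf : exists f : 'rV[R]_n -> R,
      [/\ radial_on (punctured_ball eps) f,
          is_solution m alpha beta (punctured_ball eps) f &
          enorm x `^ gamma * f x @[x --> (0 : 'rV[R]_n)^'] --> eta]) :
  (alpha = 0 /\ beta = 0) \/
  [/\ beta <> 0, gamma = alpha / beta & 2 / (1 - m) < gamma].
Proof.
have [f [radf solf liml]] := hf.
pose j : 'I_n := Ordinal (ltn_trans (ltn0Sn 1) hn).
have n3 : 3 <= n%:R :> R by rewrite ler_nat.
have mn : m * n%:R < n%:R - 2 by rewrite -ltr_pdivlMr//; lra.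
have m1 : m < 1 by nra.
have m1' : 0 < 1 - m by rewrite subr_gt0.
have [du [dW [ddW prof]]] := radial_profile j (lt0r_neq0 hm0) radf solf.
have ul : r `^ gamma * f (r *: delta_mx 0 j) @[r --> 0^'+] --> eta.
  apply: near_eq_cvg_lim
    (cvg_comp (fun r : R => r *: delta_mx 0 j) _ (cvg_axis_dnbhs j) liml); near=> r.
  by rewrite /= enorm_axis.
have key q := exponent_balance heps heta prof ul (q := q).
have [gsub|gsup|geq] := ltgtP gamma (2 / (1 - m)).
(* Here the diffusion term dominates, and q = gamma m isolates it. *)
- exfalso; move: gsub; rewrite ltr_pdivlMr// => gsub.
  have gm : gamma - 2 < gamma * m by lra.
  have := key _ (lexx _) (ltW gm).
  rewrite eqxx gt_eqF// mul0r mulr0 addr0 mul1r.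
  have ne : n%:R - 2 - gamma * m != 0.
    apply/eqP => nE; have : (n%:R - 2) * (1 - m) < 2 * m.
      have -> : n%:R - 2 = gamma * m by lra.
      by rewrite mulrAC ltr_pM2r.
    by lra.
  apply/eqP/mulf_neq0; first by rewrite mulf_neq0// gt_eqF// mulr_gt0.
  by rewrite gt_eqF// divr_gt0// powR_gt0.
(* Here the lower-order terms dominate, and q = gamma - 2 isolates them. *)
- move: (gsup); rewrite ltr_pdivrMr// => gsup'.
  have gm : gamma * m < gamma - 2 by lra.
  have := key _ (ltW gm) (lexx _).
  rewrite eqxx gt_eqF// mul0r mulr0 add0r mul1r subrK => /eqP.
  rewrite mulf_eq0 (gt_eqF heta) orbF subr_eq0 => /eqP bg.
  have [b0|b0] := eqVneq beta 0; [left|right].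
    by rewrite -bg b0 mul0r.
  by split; [exact/eqP | rewrite -bg mulrC mulKf | ].
- by [].
Unshelve. all: by end_near. Qed.
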